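(* Let $G$ be a simple connected undirected graph with $n\ge 2$ vertices, resistance degrees $R_1,\dots,R_n$ and second resistance degrees $T_1,\dots,T_n$. Then $$\rho_1(G)\ge\sqrt{\frac{T_1^2+\cdots+T_n^2}{R_1^2+\cdots+R_n^2}},$$ and equality holds if and only if $G$ is pseudo resistance regular.
   Context: For a connected graph $G$ with vertices $v_1,\dots,v_n$, Laplacian matrix $L$ (degree matrix minus adjacency matrix) and Moore-Penrose inverse $L^\dagger=(l^\dagger_{ij})$, the resistance distance is $r_{ij}=l^\dagger_{ii}+l^\dagger_{jj}-2l^\dagger_{ij}$, and the resistance distance matrix is $R(G)=(r_{ij})_{n\times n}$. The resistance degrees are $R_i=\sum_{j=1}^n r_{ij}$ and the second resistance degrees are $T_i=\sum_{j=1}^n r_{ij}R_j$. $G$ is pseudo resistance regular if there is a constant $k$ with $T_i/R_i=k$ for all $i$. The resistance spectral radius $\rho_1(G)$ is the largest eigenvalue of $R(G)$ (equivalently, the maximum of the absolute values of its eigenvalues). *)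

(* Defs.v *)
From HB Require Import structures.
From mathcomp Require Import all_boot all_order all_algebra.
From mathcomp Require Import boolp classical_sets reals.
From mathcomp Require Import complex polyrcf.

Set Implicit Arguments.
Unset Strict Implicit.
Unset Printing Implicit Defensive.

Import Order.TTheory GRing.Theory Num.Theory.
Local Open Scope ring_scope.

Section LinearAlgebra.
Variable R : realType.

(* The four Penrose conditions. *)
Definition is_moore_penrose m n (A : 'M[R]_(m, n)) (X : 'M[R]_(n, m)) : Prop :=
  [/\ A *m X *m A = A, X *m A *m X = X,
      (A *m X)^T = A *m X & (X *m A)^T = X *m A].

(* MathComp's pinvmx is only a generalized inverse, not the Moore-Penrose one.
   The default 0 is never used, by moore_penroseP below. *)
Definition moore_penrose m n (A : 'M[R]_(m, n)) : 'M[R]_(n, m) :=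
  xget 0 [set X | is_moore_penrose A X]%classic.

Definition is_largest_eigenvalue n (A : 'M[R]_n) (a : R) : Prop :=
  eigenvalue A a /\ forall b, eigenvalue A b -> b <= a.

(* Meaningful when A has a real eigenvalue, in particular when A is symmetric
   and n > 0 (largest_eigenvalueP below). *)
Definition largest_eigenvalue n (A : 'M[R]_n) : R :=
  xget 0 [set a | is_largest_eigenvalue A a]%classic.

Lemma is_moore_penrose_uniq m n (A : 'M[R]_(m, n)) X Y :
  is_moore_penrose A X -> is_moore_penrose A Y -> X = Y.
Proof.
move=> [X1 X2 X3 X4] [Y1 Y2 Y3 Y4].
have AXY : A *m X = A *m Y.
  rewrite -[LHS]X3 -{1}Y1 -(mulmxA (A *m Y)) trmx_mul X3 Y3.
  by rewrite !mulmxA X1.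
have XYA : X *m A = Y *m A.
  rewrite -[LHS]X4 -{1}Y1 !mulmxA -(mulmxA (X *m A)) trmx_mul X4 Y4.
  by rewrite -!mulmxA (mulmxA A) X1.
by rewrite -X2 -mulmxA AXY mulmxA XYA Y2.
Qed.

Lemma gram_unit r n (F : 'M[R]_(r, n)) : row_free F -> F *m F^T \in unitmx.
Proof.
move=> Ffree; rewrite -row_free_unit -kermx_eq0; apply/eqP/row_matrixP => i.
rewrite row0; set x := row i _.
have xF0 : x *m (F *m F^T) = 0 by apply/sub_kermxP; rewrite row_sub.
suff : x *m F = 0.
  by move=> xF; apply: (row_free_inj Ffree); rewrite xF mul0mx.
have : (x *m F) *m (x *m F)^T = 0.
  by rewrite trmx_mul mulmxA -(mulmxA x) xF0 mul0mx.
move: (x *m F) => y /matrixP/(_ ord0 ord0); rewrite !mxE.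
under eq_bigr do rewrite mxE -expr2.
move/eqP; rewrite psumr_eq0; last by move=> j _; rewrite sqr_ge0.
move=> /allP y0; apply/rowP => j; rewrite mxE.
by have := y0 j (mem_index_enum _); rewrite sqrf_eq0 => /eqP.
Qed.

(* Existence, from a full-rank factorization A = C F :
   A^+ = F^T (F F^T)^-1 (C^T C)^-1 C^T. *)
Lemma moore_penroseP m n (A : 'M[R]_(m, n)) :
  is_moore_penrose A (moore_penrose A).
Proof.
apply: (@xgetPex _ 0 [set X | is_moore_penrose A X]%classic).
have := mulmx_base A.
have := row_base_free A; have := col_base_full A.
move: (\rank A) (col_base A) (row_base A) => r C F.
move=> Cfull Ffree defA.
have uF := gram_unit Ffree.
have uC : C^T *m C \in unitmx.
  by rewrite -{2}[C]trmxK gram_unit // /row_free mxrank_tr.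
have FK : F *m F^T *m invmx (F *m F^T) = 1%:M by rewrite mulmxV.
have CK : invmx (C^T *m C) *m (C^T *m C) = 1%:M by rewrite mulVmx.
set G := invmx _ in FK; set H := invmx _ in CK.
have GT : G^T = G by rewrite /G trmx_inv trmx_mul trmxK.
have HT : H^T = H by rewrite /H trmx_inv trmx_mul trmxK.
exists (F^T *m G *m H *m C^T); rewrite -defA /=.
have AX : C *m F *m (F^T *m G *m H *m C^T) = C *m H *m C^T.
  rewrite -(mulmxA C F) !mulmxA -(mulmxA C F) -(mulmxA C _ G).
  by rewrite FK mulmx1.
have XA : F^T *m G *m H *m C^T *m (C *m F) = F^T *m G *m F.
  by rewrite -!mulmxA (mulmxA C^T) (mulmxA H) CK mul1mx.
split; rewrite ?AX ?XA.
- by rewrite -!mulmxA (mulmxA C^T) (mulmxA H) CK mul1mx.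
- by rewrite -!mulmxA (mulmxA F) (mulmxA (F *m _)) FK mul1mx.
- by rewrite !trmx_mul trmxK HT mulmxA.
- by rewrite !trmx_mul trmxK GT mulmxA.
Qed.

Lemma sym_eigenvalue_ex n (A : 'M[R]_n) :
  (0 < n)%N -> A^T = A -> exists a, eigenvalue A a.
Proof.
move=> n0 symA.
pose toC : {rmorphism R -> R[i]} := real_complex R.
pose B := map_mx toC A.
have [z rz] : exists z, root (char_poly B) z.
  by apply/closed_rootP; rewrite size_char_poly; case: (n) n0.
have [v Bv v0] : exists2 v : 'rV_n, v *m B = z *: v & v != 0.
  by apply/eigenvalueP; rewrite eigenvalue_root_char.
pose w : 'cV[R[i]]_n := (map_mx conjc v)^T.
have Bw : B *m w = conjc z *: w.
  have BT : B^T = B by apply/matrixP=> i j; rewrite !mxE -{1}symA mxE.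
  have Bc : map_mx conjc B = B.
    by apply/matrixP=> i j; rewrite !mxE /= oppr0.
  rewrite -[LHS]trmxK trmx_mul BT trmxK -{1}Bc -map_mxM Bv map_mxZ.
  by rewrite linearZ.
have vw : (v *m w) ord0 ord0 != 0.
  rewrite mxE psumr_eq0 => [|i _]; last by rewrite !mxE mulcJ_ge0.
  apply: contra v0 => /allP v0; apply/eqP/rowP => j; rewrite mxE.
  have := v0 j (mem_index_enum _); rewrite !mxE /= mulf_eq0 conjc_eq0 orbb.
  by move/eqP.
have zz : z = conjc z.
  have /matrixP/(_ ord0 ord0) : v *m B *m w = v *m (B *m w) by rewrite mulmxA.
  rewrite Bv Bw -scalemxAl -scalemxAr !mxE -?mxE => /(mulIf _); apply.
  by move: vw; rewrite mxE.
have defz : z = toC (complex.Re z).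
  case: z zz {rz Bv Bw} => x y [] /eqP.
  by rewrite -addr_eq0 -mulr2n mulrn_eq0 /= => /eqP->.
exists (complex.Re z); rewrite eigenvalue_root_char.
by rewrite -(fmorph_root toC) map_char_poly -defz.
Qed.

Lemma largest_eigenvalueP n (A : 'M[R]_n) :
  (0 < n)%N -> A^T = A -> is_largest_eigenvalue A (largest_eigenvalue A).
Proof.
move=> n0 /(sym_eigenvalue_ex n0)[a Aa].
apply: (@xgetPex R 0 [set a | is_largest_eigenvalue A a]%classic) => /=.
have p0 : char_poly A != 0 by rewrite monic_neq0 ?char_poly_monic.
pose s := rootsR (char_poly A).
have sP b : (b \in s) = eigenvalue A b.
  by rewrite eigenvalue_root_char -(roots_on_rootsR p0 b) in_itv.
have as_ : a \in s by rewrite sP.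
exists (\big[Order.max/a]_(b <- s) b); split => /=.
  rewrite -sP big_seq; elim/big_rec: _ => // x y xs ys.
  by rewrite maxEle; case: ifP.
by move=> b; rewrite -sP => bs; exact: (@le_bigmax_seq _ _ _ _ a b xpredT id).
Qed.

End LinearAlgebra.

Section Resistance.
Variables (R : realType) (n : nat) (e : rel 'I_n).

Definition adjacency_mx : 'M[R]_n := \matrix_(i, j) (e i j)%:R.

Definition degree_mx : 'M[R]_n :=
  diag_mx (\row_i #|[set j | e i j]|%:R).

Definition laplacian_mx : 'M[R]_n := degree_mx - adjacency_mx.

Definition resistance_mx : 'M[R]_n :=
  let Ld := moore_penrose laplacian_mx in
  \matrix_(i, j) (Ld i i + Ld j j - 2 * Ld i j).

Definition resistance_degree (i : 'I_n) : R := \sum_j resistance_mx i j.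

Definition second_resistance_degree (i : 'I_n) : R :=
  \sum_j resistance_mx i j * resistance_degree j.

Definition pseudo_resistance_regular : Prop :=
  exists k : R,
    forall i, second_resistance_degree i / resistance_degree i = k.

Definition resistance_spectral_radius : R := largest_eigenvalue resistance_mx.

End Resistance.

(* Main.v *)
Require Import Defs.
From mathcomp Require Import all_boot all_order all_algebra.
From mathcomp Require Import reals.
From mathcomp Require Import complex ring.
Import Order.TTheory GRing.Theory Num.Theory.
Local Open Scope ring_scope.

(** Write [A] for the resistance matrix, [rho] for its largest eigenvalue and
[v] for the vector of resistance degrees, so that [v] collects the row sums of
[A] and, vectors being rows, [v A] is the vector of second resistance degrees.
The bound says that [|v A| <= rho |v|] for the Euclidean norm.

The resistance matrix is symmetric with zero diagonal, and its other entries
are positive ([resistance_gt0]): with [X] the Moore-Penrose inverse of the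
Laplacian [L] and [w = e_i - e_j], the resistance is [w X w^T], which equals
the Laplacian form at [w X] because [X = X L X]; it vanishes only if [w X] is
constant, that is, only if [w X L = 0], which is impossible because [w] is
orthogonal to the constants, the kernel of [L].

Since [A] is nonnegative, [rho] dominates the absolute values of all its
eigenvalues ([nonneg_eigenvalue_norm_le]), so no eigenvalue of [A^2] exceeds
[rho^2], and the Rayleigh bound for [A^2] gives [|v A| <= rho |v|], with
[v A^2 = rho^2 v] in case of equality ([symmetric_norm_mulmx]).

Pseudo resistance regularity says that [v] is an eigenvector of [A].  If it
is, then, being positive, it belongs to [rho] ([pos_eigenvector_max]), and
equality holds.  Conversely suppose that [v A^2 = rho^2 v].  For at least three
vertices all entries of [A^2] are positive, so by Perron's argument the
eigenvectors of [A^2] for [rho^2] are the multiples of a positive one, which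
forces [v A = rho v] ([perron_sqrt_eigenvector]).  For two vertices [A^2] is
scalar and this argument fails, but then [v] is constant and an eigenvector of
[A] anyway ([row_sums_eigenvector2]). *)

(** * The Rayleigh bound for symmetric matrices *)

(** The standard inner product of row vectors. *)
Definition dotr {R : realType} {n} (u v : 'rV[R]_n) : R :=
  \sum_i u 0 i * v 0 i.

Section Rayleigh.

Set Implicit Arguments.
Unset Strict Implicit.

Variable R : realType.

Lemma dotr_mulmx n (u v : 'rV[R]_n) (A : 'M[R]_n) :
  dotr (u *m A) v = dotr u (v *m A^T).
Proof.
have dE (x y : 'rV[R]_n) : dotr x y = (x *m y^T) 0 0.
  by rewrite mxE; apply: eq_bigr => i _; rewrite mxE.
by rewrite !dE trmx_mul trmxK mulmxA.
Qed.

Lemma dotr_ge0 n (u : 'rV[R]_n) : 0 <= dotr u u.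
Proof. by apply: sumr_ge0 => i _; rewrite -expr2 sqr_ge0. Qed.

Lemma dotr_gt0 n (u : 'rV[R]_n) : u != 0 -> 0 < dotr u u.
Proof.
rewrite lt_def dotr_ge0 andbT; apply: contra => /eqP u0.
apply/eqP/rowP => i; rewrite mxE; apply/eqP; rewrite -sqrf_eq0 expr2.
have /psumr_eq0P -> // : \sum_i u 0 i * u 0 i = 0 by [].
by move=> j _; rewrite -expr2 sqr_ge0.
Qed.

Lemma dotrC n (u v : 'rV[R]_n) : dotr u v = dotr v u.
Proof. by apply: eq_bigr => i _; rewrite mulrC. Qed.

Lemma dotrBr n (u v w : 'rV[R]_n) : dotr u (v - w) = dotr u v - dotr u w.
Proof. by rewrite -sumrB; apply: eq_bigr => i _; rewrite !mxE mulrBr. Qed.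

Lemma dotr_delta n (u : 'rV[R]_n) i : dotr u (delta_mx 0 i) = u 0 i.
Proof.
rewrite /dotr (bigD1 i) //= mxE !eqxx mulr1 big1 ?addr0 // => j ji.
by rewrite mxE (negPf ji) andbF mulr0.
Qed.

Lemma dotrZl n (u v : 'rV[R]_n) a : dotr (a *: u) v = a * dotr u v.
Proof. by rewrite mulr_sumr; apply: eq_bigr => i _; rewrite mxE mulrA. Qed.

(** The proof diagonalizes [A] over the complex numbers: in a unitary
eigenbasis the defect [a (v, v) - (v A, v)] is [\sum_i (a - d_i) |y_i|^2], and
the [d_i] are real, hence eigenvalues of [A]. *)
Lemma symmetric_rayleigh n (A : 'M[R]_n) (a : R) (v : 'rV[R]_n) :
  A^T = A -> (forall b, eigenvalue A b -> b <= a) ->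
  dotr (v *m A) v <= a * dotr v v /\
  (dotr (v *m A) v = a * dotr v v -> v *m A = a *: v).
Proof.
move=> symA a_ub.
pose toC : {rmorphism R -> R[i]} := real_complex R.
have toCJ x : (toC x)^* = toC x by rewrite /= /Num.conj /= oppr0.
pose B := map_mx toC A; pose w := map_mx toC v.
pose P := spectralmx B; pose d := spectral_diag B.
have wJ : map_mx Num.conj w^T = w^T.
  by apply/matrixP => i j; rewrite !mxE toCJ.
have hermB : B \is hermsymmx.
  apply/is_hermitianmxP; rewrite expr0 scale1r.
  by apply/matrixP => i j; rewrite !mxE -{1}symA mxE toCJ.
have defB : B = invmx P *m diag_mx d *m P.
  exact/orthomx_spectralP/hermitian_normalmx.
have uP : P \in unitmx := spectral_unit B.
have PV : invmx P = map_mx Num.conj P^T.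
  exact/invmx_unitary/spectral_unitarymx.
pose y := w *m invmx P.
have yJ : map_mx Num.conj y^T = P *m w^T.
  rewrite trmx_mul map_mxM wJ PV map_trmx trmxK -map_mx_comp map_mx_id //.
  exact: conjCK.
have dreal i : exists2 b, d 0 i = toC b & b <= a.
  have /mxOverP/(_ 0 i) dR : d \is a mxOver Num.real.
    exact: hermitian_spectral_diag_real.
  have [b db] : exists b, d 0 i = toC b.
    by move: dR => /complex_realP[b ->]; exists b.
  exists b => //; apply: a_ub; rewrite eigenvalue_root_char.
  rewrite -(fmorph_root toC) map_char_poly -/B -db -eigenvalue_root_char.
  apply/eigenvalueP; exists (row i P).
    have PB : P *m B = diag_mx d *m P by rewrite defB !mulmxA mulmxV // mul1mx.
    by rewrite -row_mul PB; apply/rowP => j; rewrite mul_diag_mx !mxE.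
  apply/negP => /eqP/(congr1 (mulmx^~ (invmx P))).
  rewrite mul0mx -row_mul mulmxV // => /rowP/(_ i); rewrite !mxE eqxx => /eqP.
  by rewrite oner_eq0.
have form (u : 'rV[R]_n) : toC (dotr u v) = (map_mx toC u *m w^T) 0 0.
  by rewrite rmorph_sum mxE; apply: eq_bigr => i _; rewrite !mxE rmorphM.
have wB : w *m B = y *m diag_mx d *m P by rewrite defB !mulmxA.
have wE : w = y *m P by rewrite mulmxKV.
clearbody y.
have defect : toC (a * dotr v v - dotr (v *m A) v) =
    \sum_i (toC a - d 0 i) * `|y 0 i| ^+ 2.
  rewrite rmorphB rmorphM !form map_mxM -/w -/B wB {1}wE -!mulmxA -yJ.
  rewrite !mxE mulr_sumr -sumrB; apply: eq_bigr => i _.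
  rewrite mul_diag_mx !mxE normCK; ring.
have term_ge0 i : 0 <= (toC a - d 0 i) * `|y 0 i| ^+ 2.
  have [b -> ba] := dreal i.
  by rewrite mulr_ge0 ?exprn_ge0 // subr_ge0 lecR.
split.
  by rewrite -subr_ge0 -lecR; rewrite -/(toC _) defect; apply: sumr_ge0.
move=> veq; move: defect; rewrite veq subrr rmorph0 => /esym d0.
have yd : y *m diag_mx d = toC a *: y.
  apply/rowP => i; rewrite mul_mx_diag !mxE.
  have /eqP : (toC a - d 0 i) * `|y 0 i| ^+ 2 = 0.
    exact: psumr_eq0P d0 _ _.
  rewrite mulf_eq0 subr_eq0 expf_eq0 normr_eq0 /= => /orP[]/eqP-> //.
    by rewrite mulrC.
  by rewrite mulr0 mul0r.
apply: (@map_mx_inj _ _ toC).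
by rewrite map_mxM map_mxZ -/w -/B wB yd -scalemxAl -wE.
Qed.

(** If [v] is an eigenvector for [b], then the Rayleigh quotient of [A] at the
entrywise absolute value [|v|] is at least [|b|]. *)
Lemma nonneg_eigenvalue_norm_le n (A : 'M[R]_n) (a b : R) :
  A^T = A -> (forall i j, 0 <= A i j) ->
  (forall c, eigenvalue A c -> c <= a) -> eigenvalue A b -> `|b| <= a.
Proof.
move=> symA A_ge0 a_ub /eigenvalueP[v vA v0].
pose u := map_mx Num.norm v.
have uu : 0 < dotr u u.
  apply: dotr_gt0; apply: contra v0 => /eqP u0; apply/eqP/rowP => i.
  by move/rowP: u0 => /(_ i); rewrite !mxE => /normr0P/eqP.
rewrite -(ler_pM2r uu); have [uAu _] := symmetric_rayleigh u symA a_ub.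
apply: le_trans uAu; rewrite /dotr mulr_sumr; apply: ler_sum => i _.
rewrite mulrA ler_wpM2r ?mxE // -normrM.
have /rowP/(_ i) := vA; rewrite !mxE => <-.
apply: le_trans (ler_norm_sum _ _ _) _; apply: ler_sum => j _.
by rewrite mxE normrM (ger0_norm (A_ge0 _ _)).
Qed.

(** Every eigenvalue of [A^2] has the form [s^2] with [s] or [- s] an
eigenvalue of [A], because [A^2 - s^2 = (A + s) (A - s)]; so the Rayleigh bound
for [A^2] bounds the norm of [v A]. *)
Lemma symmetric_norm_mulmx n (A : 'M[R]_n) (a : R) (v : 'rV[R]_n) :
  A^T = A -> (forall b, eigenvalue A b -> `|b| <= a) ->
  dotr (v *m A) (v *m A) <= a ^+ 2 * dotr v v /\
  (dotr (v *m A) (v *m A) = a ^+ 2 * dotr v v ->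
   v *m A *m A = a ^+ 2 *: v).
Proof.
move=> symA a_ub.
have symAA : (A *m A)^T = A *m A by rewrite trmx_mul symA.
have formAA x : dotr (x *m (A *m A)) x = dotr (x *m A) (x *m A).
  by rewrite mulmxA dotr_mulmx symA.
have sq_ub b : eigenvalue (A *m A) b -> b <= a ^+ 2.
  move=> /eigenvalueP[x xAA x0].
  have b_ge0 : 0 <= b.
    by rewrite -(pmulr_lge0 _ (dotr_gt0 x0)) -dotrZl -xAA formAA dotr_ge0.
  have [s s_ge0 defb] : exists2 s, 0 <= s & b = s ^+ 2.
    by exists (Num.sqrt b); rewrite ?sqrtr_ge0 ?sqr_sqrtr.
  suff [c cA cs] : exists2 c, eigenvalue A c & `|c| = s.
    by rewrite defb ler_pXn2r ?nnegrE // -?cs ?a_ub // (le_trans _ (a_ub c cA)).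
  have [y0|y0] := eqVneq (x *m A + s *: x) 0.
    exists (- s); last by rewrite normrN ger0_norm.
    apply/eigenvalueP; exists x => //.
    by apply/eqP; rewrite scaleNr -addr_eq0 y0.
  exists s; last by rewrite ger0_norm.
  apply/eigenvalueP; exists (x *m A + s *: x) => //.
  rewrite mulmxDl -mulmxA xAA -scalemxAl defb expr2 -scalerA scalerDr.
  by rewrite addrC.
rewrite -formAA -mulmxA; exact: symmetric_rayleigh.
Qed.

End Rayleigh.

(** * Positive eigenvectors *)

Section Perron.

Set Implicit Arguments.
Unset Strict Implicit.

Variable R : realType.

(** The vector [x = v A + a v] is a positive eigenvector of [A] for [a], hence
of [A^2] for [a^2].  Subtracting from [v] the largest multiple of [x] that
keeps it nonnegative leaves a nonnegative solution of [y A^2 = a^2 y] with a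
zero entry, and [y] must vanish because [A^2] has positive entries. *)
Lemma perron_sqrt_eigenvector n (A : 'M[R]_n) (a : R) (v : 'rV[R]_n) :
  (2 < n)%N -> 0 <= a -> (forall i, 0 <= A i i) ->
  (forall i j, i != j -> 0 < A i j) -> (forall i, 0 < v 0 i) ->
  v *m A *m A = a ^+ 2 *: v -> v *m A = a *: v.
Proof.
move=> n_gt2 a_ge0 A_diag A_off v_gt0 vAA.
have A_ge0 i j : 0 <= A i j.
  by have [->|/A_off/ltW] := eqVneq i j.
have third (i j : 'I_n) : exists k, (k != i) && (k != j).
  have /card_gt0P[k] : (0 < #|~: [set i; j]|)%N.
    by rewrite cardsCs setCK card_ord cards2 subn_gt0; case: (i != j);
       rewrite ?(ltnW n_gt2).
  by rewrite !inE negb_or; exists k.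
(* The third index [k] gives the positive summand [A i k * A k j]. *)
have AA_gt0 i j : 0 < (A *m A) i j.
  have [k /andP[ki kj]] := third i j.
  rewrite mxE (bigD1 k) //= ltr_wpDr ?mulr_gt0 ?A_off // 1?eq_sym //.
  by apply: sumr_ge0 => l _; rewrite mulr_ge0.
pose x := v *m A + a *: v.
have x_gt0 i : 0 < x 0 i.
  have [k /andP[ki _]] := third i i.
  rewrite !mxE ltr_wpDr ?mulr_ge0 ?(ltW (v_gt0 _)) // (bigD1 k) //=.
  rewrite ltr_wpDr ?mulr_gt0 ?A_off //.
  by apply: sumr_ge0 => l _; rewrite mulr_ge0 ?(ltW (v_gt0 _)).
have xA : x *m A = a *: x.
  by rewrite mulmxDl vAA -scalemxAl expr2 -scalerA -scalerDr addrC.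
clearbody x.
pose i0 := Ordinal (ltnW (ltnW n_gt2)).
pose m := [arg min_(i < i0) (v 0 i / x 0 i)]%O.
pose c := v 0 m / x 0 m.
pose y := v - c *: x.
have ym : y 0 m = 0 by rewrite !mxE /c divfK ?subrr // gt_eqF.
have y_ge0 i : 0 <= y 0 i.
  rewrite !mxE subr_ge0 -ler_pdivlMr // /c /m.
  by case: arg_minP => // j _; apply.
have yAA : y *m (A *m A) = a ^+ 2 *: y.
  rewrite mulmxBl -scalemxAl !mulmxA vAA xA -scalemxAl xA.
  by rewrite scalerBr !scalerA; congr (_ - _ *: _); ring.
have y0 : y = 0.
  apply/rowP => j; rewrite [RHS]mxE; apply/eqP.
  have /eqP : y 0 j * (A *m A) j m = 0.
    have : \sum_i y 0 i * (A *m A) i m = 0.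
      by move/rowP: yAA => /(_ m); rewrite mxE => ->; rewrite mxE ym mulr0.
    by move/psumr_eq0P => -> // i _; rewrite mulr_ge0 // ltW.
  by rewrite mulf_eq0 (gt_eqF (AA_gt0 _ _)) orbF.
have -> : v = c *: x by apply/eqP; rewrite -subr_eq0 -/y y0.
by rewrite -scalemxAl xA !scalerA mulrC.
Qed.

(** Pair [|x|], for an eigenvector [x] for [b], with the positive eigenvector
[v]: entrywise [b |x| <= |x| A]. *)
Lemma pos_eigenvector_max n (A : 'M[R]_n) (a b : R) (v : 'rV[R]_n) :
  A^T = A -> (forall i j, 0 <= A i j) -> (forall i, 0 < v 0 i) ->
  v *m A = a *: v -> eigenvalue A b -> b <= a.
Proof.
move=> symA A_ge0 v_gt0 vA /eigenvalueP[x xA x0].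
pose u := map_mx Num.norm x.
have uv : 0 < dotr u v.
  have [i xi] := rV0Pn _ x0.
  rewrite /dotr (bigD1 i) //= ltr_wpDr //.
    by apply: sumr_ge0 => j _; rewrite mulr_ge0 ?(ltW (v_gt0 _)) // mxE.
  by rewrite mxE mulr_gt0 ?normr_gt0.
rewrite -(ler_pM2r uv).
have -> : a * dotr u v = dotr (u *m A) v.
  by rewrite dotr_mulmx symA vA [RHS]dotrC dotrZl dotrC.
rewrite /dotr mulr_sumr; apply: ler_sum => i _.
rewrite mulrA ler_wpM2r ?(ltW (v_gt0 _)) //.
rewrite mxE (le_trans (ler_norm _)) // normrM normr_id -normrM.
have /rowP/(_ i) := xA; rewrite !mxE => <-.
apply: le_trans (ler_norm_sum _ _ _) _; apply: ler_sum => j _.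
by rewrite mxE normrM (ger0_norm (A_ge0 _ _)).
Qed.

(** Such an [A] has a zero diagonal and a single off-diagonal value. *)
Lemma row_sums_eigenvector2 (A : 'M[R]_2) :
  A^T = A -> (forall i, A i i = 0) ->
  (\row_i \sum_j A i j) *m A = A 0 1 *: (\row_i \sum_j A i j).
Proof.
move=> symA A_diag; have A10 : A 1 0 = A 0 1 by rewrite -[in LHS]symA mxE.
have lift1 : lift ord0 ord0 = 1 :> 'I_2 by apply/val_inj.
have sum2 (F : 'I_2 -> R) : \sum_i F i = F 0 + F 1.
  by rewrite !big_ord_recl big_ord0 addr0 lift1.
apply/rowP => i; rewrite !mxE !sum2 !mxE !sum2 !A_diag A10.
have [->|->] : i = 0 \/ i = 1.
  by case: i => [[|[|//]] ?]; [left|right]; apply/val_inj.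
all: by rewrite ?A_diag ?A10; ring.
Qed.

End Perron.

(** * Positivity of resistance distances *)

Section Resistance.

Set Implicit Arguments.
Unset Strict Implicit.

Variables (R : realType) (n : nat) (e : rel 'I_n).
Hypotheses (e_sym : symmetric e).
Hypotheses (e_conn : forall i j : 'I_n, connect e i j).

Lemma is_moore_penrose_tr m p (A : 'M[R]_(m, p)) X :
  is_moore_penrose A X -> is_moore_penrose A^T X^T.
Proof.
by move=> [A1 A2 A3 A4]; split; rewrite -!trmx_mul ?mulmxA ?A1 ?A2 ?A3 ?A4.
Qed.

Lemma moore_penrose_sym p (A : 'M[R]_p) :
  A^T = A -> (moore_penrose A)^T = moore_penrose A.
Proof.
move=> symA; apply: (is_moore_penrose_uniq (A := A)).
  by rewrite -{1}symA; apply/is_moore_penrose_tr/moore_penroseP.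
exact: moore_penroseP.
Qed.

Let L : 'M[R]_n := laplacian_mx R e.

Lemma laplacian_sym : L^T = L.
Proof.
apply/matrixP => i j; rewrite !mxE (e_sym j) eq_sym.
by have [->|] := eqVneq i j; rewrite ?mulr0n.
Qed.

(** Each edge is counted twice on the right, once in each direction. *)
Lemma laplacian_form (u : 'rV[R]_n) :
  2 * dotr (u *m L) u = \sum_i \sum_j (e i j)%:R * (u 0 i - u 0 j) ^+ 2.
Proof.
have S1 : \sum_i \sum_j (e i j)%:R * u 0 i ^+ 2 =
          \sum_i \sum_j (e i j)%:R * u 0 j ^+ 2.
  rewrite exchange_big; apply: eq_bigr => i _; apply: eq_bigr => j _.
  by rewrite e_sym.
have -> : dotr (u *m L) u =
    \sum_i \sum_j ((e i j)%:R * u 0 i ^+ 2 - (e i j)%:R * (u 0 i * u 0 j)).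
  apply: eq_bigr => i _; rewrite mulmxBr mxE mul_mx_diag !mxE mulrBl sumrB.
  congr (_ - _).
    rewrite -sum1dep_card natr_sum big_mkcond mulr_sumr mulr_suml.
    by apply: eq_bigr => j _; case: (e i j) => /=; ring.
  by rewrite mulr_suml; apply: eq_bigr => j _; rewrite mxE (e_sym j); ring.
rewrite (eq_bigr (fun i => \sum_j (e i j)%:R * u 0 i ^+ 2 -
                           \sum_j (e i j)%:R * (u 0 i * u 0 j))); last first.
  by move=> i _; rewrite sumrB.
rewrite sumrB mulrBr mulr2n mulrDl !mul1r {2}S1.
rewrite mulr_sumr -big_split -sumrB; apply: eq_bigr => i _.
rewrite mulr_sumr -big_split -sumrB; apply: eq_bigr => j _ /=.
by ring.
Qed.

Lemma laplacian_form_ge0 (u : 'rV[R]_n) : 0 <= dotr (u *m L) u.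
Proof.
rewrite -(pmulr_rge0 _ (ltr0n R 2)) laplacian_form.
by apply: sumr_ge0 => i _; apply: sumr_ge0 => j _; rewrite mulr_ge0 ?sqr_ge0.
Qed.

Lemma laplacian_form_eq0 (u : 'rV[R]_n) :
  dotr (u *m L) u = 0 -> forall i j, u 0 i = u 0 j.
Proof.
move=> u0; have := laplacian_form u; rewrite u0 mulr0 => /esym s0.
have edge i j : e i j -> u 0 i = u 0 j.
  move=> eij; apply/eqP; rewrite -subr_eq0 -sqrf_eq0; apply/eqP.
  have term_ge0 k l : 0 <= (e k l)%:R * (u 0 k - u 0 l) ^+ 2.
    by rewrite mulr_ge0 ?sqr_ge0.
  have si : \sum_l (e i l)%:R * (u 0 i - u 0 l) ^+ 2 = 0.
    by apply: psumr_eq0P s0 _ _ => // k _; apply: sumr_ge0.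
  have : (e i j)%:R * (u 0 i - u 0 j) ^+ 2 = 0 by apply: psumr_eq0P si _ _.
  by rewrite eij mul1r.
move=> i j; have /connectP[p] := e_conn i j.
elim: p i => [i _ -> //|k p IHp i /= /andP[/edge -> kp] jl].
exact: IHp.
Qed.

Lemma const_laplacian (u : 'rV[R]_n) :
  (forall i j, u 0 i = u 0 j) -> u *m L = 0.
Proof.
move=> uc; apply/rowP => i; rewrite mulmxBr mxE mul_mx_diag !mxE.
rewrite -sum1dep_card natr_sum big_mkcond mulr_sumr -sumrB big1 // => j _.
by rewrite mxE (uc j i) (e_sym j); case: (e i j) => /=; ring.
Qed.

Lemma resistance_sym i j : resistance_mx R e i j = resistance_mx R e j i.
Proof.
rewrite !mxE -[in LHS](moore_penrose_sym laplacian_sym) !mxE; ring.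
Qed.

Lemma resistance_diag i : resistance_mx R e i i = 0.
Proof. by rewrite mxE; ring. Qed.

(** The resistance distance is the Laplacian energy of the potential
[w X] created by a unit current from [i] to [j]. *)
Lemma resistance_gt0 i j : i != j -> 0 < resistance_mx R e i j.
Proof.
move=> ij; pose X := moore_penrose L.
have XT : X^T = X by apply: moore_penrose_sym laplacian_sym.
have [LXL XLX _ XL_sym] : is_moore_penrose L X := moore_penroseP L.
pose w : 'rV[R]_n := delta_mx 0 i - delta_mx 0 j.
have wM (M : 'M[R]_n) : w *m M = row i M - row j M.
  by rewrite mulmxBl -!rowE.
have form : resistance_mx R e i j = dotr (w *m X *m L) (w *m X).
  have <- : dotr (w *m X) w = dotr (w *m X *m L) (w *m X).
    by rewrite -{1}XLX !mulmxA dotr_mulmx XT.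
  have Xij : X i j = X j i by rewrite -[in LHS]XT mxE.
  by rewrite dotrBr !dotr_delta wM !mxE -/L -/X Xij; ring.
rewrite form lt_def laplacian_form_ge0 andbT; apply/eqP.
move=> /laplacian_form_eq0 /const_laplacian wXL.
(* [1 - X L] is the orthogonal projection onto the kernel of [L], so its rows
   are constant; being symmetric, it has equal rows. *)
pose Q := 1%:M - X *m L.
have QT : Q^T = Q by rewrite linearB /= trmx1 XL_sym.
have QL : Q *m L = 0.
  apply: trmx_inj; rewrite trmx_mul QT laplacian_sym trmx0.
  by rewrite mulmxBr mulmx1 mulmxA LXL subrr.
have defI : 1%:M = Q + X *m L by rewrite subrK.
clearbody Q.
have Qrow k l m : Q k l = Q k m.
  have /laplacian_form_eq0/(_ l m) : dotr (row k Q *m L) (row k Q) = 0.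
    rewrite -row_mul QL /dotr big1 // => h _.
    by rewrite mxE mxE mul0r.
  by rewrite mxE [in RHS]mxE.
have wQ : w *m Q = 0.
  rewrite wM; apply/rowP => k; rewrite -{1 2}QT !mxE.
  by rewrite (Qrow k i j) subrr.
have w0 : w = 0.
  by rewrite -[w]mulmx1 defI mulmxDr wQ mulmxA wXL addr0.
move/rowP: w0 => /(_ i); rewrite !mxE !eqxx (negPf ij) subr0 => /eqP.
by rewrite oner_eq0.
Qed.

End Resistance.

(** * The lower bound and its equality case *)

Theorem theorem4p1 (R : realType) (n : nat) (e : rel 'I_n)
    (n_ge2 : (2 <= n)%N)
    (e_sym : symmetric e) (e_irr : irreflexive e)
    (e_conn : forall i j : 'I_n, connect e i j) :
  let bound : R :=
    Num.sqrt ((\sum_i second_resistance_degree R e i ^+ 2) /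
              (\sum_i resistance_degree R e i ^+ 2)) in
  bound <= resistance_spectral_radius R e /\
  (resistance_spectral_radius R e = bound <-> pseudo_resistance_regular R e).
Proof.
pose A := resistance_mx R e; pose rho := resistance_spectral_radius R e.
pose v : 'rV[R]_n := \row_i resistance_degree R e i.
have A_sym i j : A i j = A j i := resistance_sym R e_sym i j.
have symA : A^T = A by apply/matrixP => i j; rewrite mxE A_sym.
have A_diag i : A i i = 0 := resistance_diag R e i.
have A_off i j : i != j -> 0 < A i j := resistance_gt0 R e_sym e_conn (j := j).
have A_ge0 i j : 0 <= A i j.
  by have [->|/A_off/ltW] := eqVneq i j; rewrite ?A_diag.
have other (i : 'I_n) : exists j, j != i.
  have /card_gt0P[j] : (0 < #|[set~ i]|)%N.
    by rewrite cardsC1 card_ord -subn1 subn_gt0.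
  by rewrite !inE; exists j.
have v_gt0 i : 0 < v 0 i.
  have [j ji] := other i.
  rewrite mxE /resistance_degree (bigD1 j) //= ltr_wpDr ?sumr_ge0 //.
  by rewrite A_off // eq_sym.
have vA : v *m A = \row_i second_resistance_degree R e i.
  apply/rowP => i; rewrite !mxE; apply: eq_bigr => j _.
  by rewrite mxE mulrC -/A A_sym.
have [rho_eig rho_ub] : is_largest_eigenvalue A rho.
  exact: largest_eigenvalueP (ltnW n_ge2) symA.
have norm_ub b : eigenvalue A b -> `|b| <= rho.
  exact: nonneg_eigenvalue_norm_le.
have rho_ge0 : 0 <= rho := le_trans (normr_ge0 rho) (norm_ub _ rho_eig).
have sumR : \sum_i resistance_degree R e i ^+ 2 = dotr v v.
  by apply: eq_bigr => i _; rewrite !mxE expr2.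
have sumT : \sum_i second_resistance_degree R e i ^+ 2
    = dotr (v *m A) (v *m A).
  by rewrite vA; apply: eq_bigr => i _; rewrite !mxE expr2.
have vv_gt0 : 0 < dotr v v.
  apply: dotr_gt0; apply/rV0Pn; exists (Ordinal n_ge2).
  by rewrite gt_eqF.
have [norm_le norm_eq] := symmetric_norm_mulmx v symA norm_ub.
(* The divisions are harmless because resistance degrees are positive. *)
have regularP k : v *m A = k *: v <->
    forall i, second_resistance_degree R e i / resistance_degree R e i = k.
  have vE i : v 0 i = resistance_degree R e i by rewrite mxE.
  have vAE i : (v *m A) 0 i = second_resistance_degree R e i.
    by rewrite vA mxE.
  split=> [vAk i|Tk].
    by rewrite -vE -vAE vAk mxE mulfK // gt_eqF.
  apply/rowP => i; rewrite vAE [RHS]mxE -(Tk i) vE divfK //.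
  by rewrite -vE gt_eqF.
move=> bound; rewrite -/rho.
have quot_ge0 : 0 <= dotr (v *m A) (v *m A) / dotr v v.
  by rewrite divr_ge0 ?dotr_ge0.
have bound_le : bound <= rho.
  rewrite /bound sumR sumT -[leRHS]ger0_norm // -sqrtr_sqr ler_wsqrtr //.
  by rewrite ler_pdivrMr.
split=> //; split=> [rho_bound|[k /regularP vAk]]; last first.
  have k_ge0 : 0 <= k.
    pose i := Ordinal n_ge2.
    rewrite -(pmulr_lge0 _ (v_gt0 i)).
    have -> : k * v 0 i = (v *m A) 0 i by rewrite vAk [RHS]mxE.
    by rewrite mxE sumr_ge0 // => j _; rewrite mulr_ge0 // ltW.
  have boundE : bound = k.
    rewrite /bound sumR sumT vAk dotrZl dotrC dotrZl mulrA -expr2.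
    by rewrite mulfK ?gt_eqF // sqrtr_sqr ger0_norm.
  apply/eqP; rewrite eq_le bound_le boundE andbT.
  exact: pos_eigenvector_max symA A_ge0 v_gt0 vAk rho_eig.
have [n_gt2|n_le2] := ltnP 2 n.
  exists rho; apply/regularP.
  apply: perron_sqrt_eigenvector => //; apply: norm_eq.
  by rewrite rho_bound /bound sumR sumT sqr_sqrtr // divfK // gt_eqF.
have n2 : n = 2%N by apply/eqP; rewrite eqn_leq n_le2.
clear - n2 regularP symA A_diag; subst n.
by exists (A 0 1); apply/regularP/row_sums_eigenvector2.
Qed.
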